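(* Let $\Phi=(A;A^*;\{E_i\}_{i=0}^d;\{E_i^*\}_{i=0}^d)$ and $\Phi'=(A';A^{*\prime};\{E_i'\}_{i=0}^{d'};\{E_i^{*\prime}\}_{i=0}^{d'})$ be Leonard systems over a field $\mathbb{K}$ with diameters $d$ and $d'$ respectively, where $1\leqslant d'\leqslant d$, with underlying vector spaces $V$, $V'$ and parameter arrays $(\{\theta_i\}_{i=0}^d;\{\theta_i^*\}_{i=0}^d;\{\varphi_i\}_{i=1}^d;\{\phi_i\}_{i=1}^d)$ and $(\{\theta_i'\}_{i=0}^{d'};\{\theta_i^{*\prime}\}_{i=0}^{d'};\{\varphi_i'\}_{i=1}^{d'};\{\phi_i'\}_{i=1}^{d'})$ respectively. Let $\rho$ be an integer with $0\leqslant\rho\leqslant d-d'$. Then $\Phi'$ is a $\rho$-descendent of $\Phi$ if and only if (i) and (ii) below hold: (i) There are scalars $\xi^*,\zeta^*\in\mathbb{K}$ such that $\theta_i^{*\prime}=\xi^*\theta_{\rho+i}^*+\zeta^*$ for $0\leqslant i\leqslant d'$. (ii) $\dfrac{\phi_i'}{\varphi_i'}=\dfrac{\phi_{\rho+i}}{\varphi_{\rho+i}}$ for $1\leqslant i\leqslant d'$. Moreover, if (i), (ii) hold, then a bilinear form $(\cdot|\cdot):V\times V'\rightarrow\mathbb{K}$ which is $\rho$-balanced with respect to $\Phi$, $\Phi'$ is unique up to scalar multiplication.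
   Context: Leonard systems. Let $\mathbb{K}$ be a field, $d$ a positive integer, $\mathcal{A}$ a $\mathbb{K}$-algebra isomorphic to $\mathrm{Mat}_{d+1}(\mathbb{K})$, and $V$ an irreducible left $\mathcal{A}$-module (so $\dim V=d+1$). An element of $\mathcal{A}$ is multiplicity-free if it has $d+1$ mutually distinct eigenvalues in $\mathbb{K}$; the primitive idempotent associated with an eigenvalue is the projection (element of $\mathcal{A}$) onto the corresponding eigenspace along the other eigenspaces. A Leonard system in $\mathcal{A}$ (over $\mathbb{K}$, of diameter $d$, with underlying vector space $V$) is a sequence $\Phi=(A;A^*;\{E_i\}_{i=0}^d;\{E_i^*\}_{i=0}^d)$ such that: $A,A^*\in\mathcal{A}$ are multiplicity-free; $\{E_i\}_{i=0}^d$ is an ordering of the primitive idempotents of $A$; $\{E_i^*\}_{i=0}^d$ is an ordering of the primitive idempotents of $A^*$; for $0\leqslant i,j\leqslant d$, $E_i^*AE_j^*=0$ if $|i-j|>1$ and $\ne 0$ if $|i-j|=1$; and $E_iA^*E_j=0$ if $|i-j|>1$ and $\ne0$ if $|i-j|=1$. Parameter array. Let $\theta_i$ (resp. $\theta_i^*$) be the eigenvalue of $A$ (resp. $A^*$) associated with $E_i$ (resp. $E_i^*$). It is known that there are scalars $\varphi_1,\dots,\varphi_d\in\mathbb{K}$ (uniquely determined by $\Phi$, and all nonzero) and a $\mathbb{K}$-algebra isomorphism $\mathcal{A}\to\mathrm{Mat}_{d+1}(\mathbb{K})$ sending $A$ to the lower bidiagonal matrix with diagonal $\theta_0,\theta_1,\dots,\theta_d$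 and all subdiagonal entries $1$, and $A^*$ to the upper bidiagonal matrix with diagonal $\theta_0^*,\theta_1^*,\dots,\theta_d^*$ and superdiagonal entries $\varphi_1,\dots,\varphi_d$. Let $\phi_1,\dots,\phi_d$ be the scalars obtained in the same way (in the role of the $\varphi_i$) from the Leonard system $\Phi^{\Downarrow}=(A;A^*;\{E_{d-i}\}_{i=0}^d;\{E_i^*\}_{i=0}^d)$; these are also all nonzero. The parameter array of $\Phi$ is $p(\Phi)=(\{\theta_i\}_{i=0}^d;\{\theta_i^*\}_{i=0}^d;\{\varphi_i\}_{i=1}^d;\{\phi_i\}_{i=1}^d)$. Objects associated with $\Phi'$ carry a prime. Balanced bilinear forms. A nonzero bilinear form $(\cdot|\cdot):V\times V'\to\mathbb{K}$ is balanced with respect to $\Phi,\Phi'$ if: (B1) there is an integer $\rho$ ($0\leqslant\rho\leqslant d-d'$) such that $(E_i^*V|E_j^{*\prime}V')=0$ whenever $i-\rho\ne j$ ($0\leqslant i\leqslant d$, $0\leqslant j\leqslant d'$); (B2) $(E_iV|E_j'V')=0$ whenever $i<j$ or $i>j+d-d'$ ($0\leqslant i\leqslant d$, $0\leqslant j\leqslant d'$). With this $\rho$ (the endpoint) the form is called $\rho$-balanced. $\Phi'$ is called a $\rho$-descendent of $\Phi$ if a $\rho$-balanced bilinear form with respect to $\Phi,\Phi'$ exists. *)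

(* Defs.v *)
From HB Require Import structures.
From mathcomp Require Import all_boot all_order all_algebra.

Set Implicit Arguments.
Unset Strict Implicit.
Unset Printing Implicit Defensive.

Import Order.TTheory GRing.Theory Num.Theory.
Local Open Scope ring_scope.

(* An A-module V over a K-algebra A, seen as a K-vector space: t acts as the
   element t%:A of A. *)
Definition vspace_of (K : fieldType) (A : algType K) (V : lmodType A) : Type :=
  V.

Section RestrictScalars.
Variables (K : fieldType) (A : algType K) (V : lmodType A).

HB.instance Definition _ := GRing.Zmodule.copy (vspace_of V) V.

Let scale (t : K) (v : vspace_of V) : vspace_of V := (t%:A : A) *: (v : V).

Fact vspace_of_scalerA a b v : scale a (scale b v) = scale (a * b) v.
Proof. by rewrite /scale scalerA -scalerAl mul1r scalerA. Qed.

Fact vspace_of_scale1r : left_id 1 scale.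
Proof. by move=> v; rewrite /scale !scale1r. Qed.

Fact vspace_of_scalerDr : right_distributive scale +%R.
Proof. by move=> t u v; rewrite /scale scalerDr. Qed.

Fact vspace_of_scalerDl v : {morph scale^~ v : a b / a + b}.
Proof. by move=> a b; rewrite /scale !scalerDl. Qed.

HB.instance Definition _ := GRing.Zmodule_isLmodule.Build K (vspace_of V)
  vspace_of_scalerA vspace_of_scale1r vspace_of_scalerDr vspace_of_scalerDl.

End RestrictScalars.

Definition is_matrix_algebra (K : fieldType) (d : nat) (A : algType K) : Prop :=
  exists f : {lrmorphism A -> 'M[K]_d.+1}, bijective f.

Definition irreducible_module (K : fieldType) (A : algType K) (V : lmodType A) :
    Prop :=
  (exists v : V, v != 0) /\
  (forall W : {pred V}, submod_closed W ->
     (forall v, v \in W -> v = 0) \/ (forall v, v \in W)).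

Section Eigenvalues.
Variables (K : fieldType) (d : nat) (A : algType K) (V : lmodType A).

(* v is in the eigenspace of a for t; v may be 0 and the space trivial *)
Definition in_eigenspace (a : A) (t : K) (v : V) : Prop :=
  a *: v = t *: (v : vspace_of V).

Definition is_eigenvalue (a : A) (t : K) : Prop :=
  exists2 v : V, v != 0 & in_eigenspace a t v.

Definition multiplicity_free (a : A) : Prop :=
  exists2 th : 'I_d.+1 -> K, injective th & forall i, is_eigenvalue a (th i).

(* e is the projection of V onto the t-eigenspace of a along the other
   eigenspaces; this determines e when a is multiplicity-free, as V is then the
   sum of the eigenspaces and is faithful. *)
Definition primitive_idempotent_for (a : A) (t : K) (e : A) : Prop :=
  [/\ is_eigenvalue a t,
      forall v : V, in_eigenspace a t v -> e *: v = v
    & forall (s : K) (v : V), s != t -> in_eigenspace a s v -> e *: v = 0].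

Definition primitive_idempotent (a e : A) : Prop :=
  exists t, primitive_idempotent_for a t e.

Definition ordering_of_primitive_idempotents (a : A) (E : 'I_d.+1 -> A) :
    Prop :=
  injective E /\ forall e, primitive_idempotent a e <-> exists i, E i = e.

(* Finite sequences of scalars are functions on nat of which only the entries
   in the index range of the sequence are used. *)
Definition eigenvalue_sequence (a : A) (E : 'I_d.+1 -> A) (th : nat -> K) :
    Prop :=
  forall i : 'I_d.+1, primitive_idempotent_for a (th i) (E i).

End Eigenvalues.

Arguments is_eigenvalue {K A} V a t.
Arguments multiplicity_free {K} d {A} V a.
Arguments primitive_idempotent_for {K A} V a t e.
Arguments primitive_idempotent {K A} V a e.
Arguments ordering_of_primitive_idempotents {K d A} V a E.
Arguments eigenvalue_sequence {K d A} V a E th.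

Record leonard_data (K : fieldType) (A : algType K) (d : nat) := LeonardData {
  lA : A;
  lAs : A;
  lE : 'I_d.+1 -> A;
  lEs : 'I_d.+1 -> A
}.

Definition irreducible_tridiagonal (K : fieldType) (A : algType K) (d : nat)
    (F : 'I_d.+1 -> A) (X : A) : Prop :=
  forall i j : 'I_d.+1,
    (`|i%:Z - j%:Z| > 1 -> F i * X * F j = 0) /\
    (`|i%:Z - j%:Z| = 1 -> F i * X * F j != 0).

Section Leonard.
Variables (K : fieldType) (d : nat) (A : algType K) (V : lmodType A).

Record leonard_system (Phi : leonard_data A d) : Prop := LeonardSystem {
  leonard_diameter : (0 < d)%N;
  leonard_algebra : is_matrix_algebra d A;
  leonard_module : irreducible_module V;
  leonard_mfA : multiplicity_free d V (lA Phi);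
  leonard_mfAs : multiplicity_free d V (lAs Phi);
  leonard_E : ordering_of_primitive_idempotents V (lA Phi) (lE Phi);
  leonard_Es : ordering_of_primitive_idempotents V (lAs Phi) (lEs Phi);
  leonard_A_tridiag : irreducible_tridiagonal (lEs Phi) (lA Phi);
  leonard_As_tridiag : irreducible_tridiagonal (lE Phi) (lAs Phi)
}.

Definition leonard_down (Phi : leonard_data A d) : leonard_data A d :=
  LeonardData (lA Phi) (lAs Phi) (fun i => lE Phi (rev_ord i)) (lEs Phi).

Definition lower_bidiagonal (th : nat -> K) : 'M[K]_d.+1 :=
  \matrix_(i, j) (if i == j then th i else if i == j.+1 :> nat then 1 else 0).

(* The superdiagonal entry in position (j - 1, j), counted from 0, is x_j, so
   that the superdiagonal reads x_1, ..., x_d. *)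
Definition upper_bidiagonal (ths x : nat -> K) : 'M[K]_d.+1 :=
  \matrix_(i, j) (if i == j then ths i else if j == i.+1 :> nat then x j else 0).

Definition split_sequence (Phi : leonard_data A d) (x : nat -> K) : Prop :=
  exists th ths : nat -> K,
    [/\ eigenvalue_sequence V (lA Phi) (lE Phi) th,
        eigenvalue_sequence V (lAs Phi) (lEs Phi) ths
      & exists f : {lrmorphism A -> 'M[K]_d.+1},
          [/\ bijective f, f (lA Phi) = lower_bidiagonal th
            & f (lAs Phi) = upper_bidiagonal ths x]].

Record parameter_array (Phi : leonard_data A d) (th ths varphi phi : nat -> K) :
    Prop := ParameterArray {
  parray_th : eigenvalue_sequence V (lA Phi) (lE Phi) th;
  parray_ths : eigenvalue_sequence V (lAs Phi) (lEs Phi) ths;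
  parray_varphi : split_sequence Phi varphi;
  parray_phi : split_sequence (leonard_down Phi) phi
}.

End Leonard.

Arguments leonard_system {K d A} V Phi.
Arguments split_sequence {K d A} V Phi x.
Arguments parameter_array {K d A} V Phi th ths varphi phi.

Section Balanced.
Variables (K : fieldType) (d d' : nat) (A A' : algType K).
Variables (V : lmodType A) (V' : lmodType A').
Variables (Phi : leonard_data A d) (Phi' : leonard_data A' d').

(* The condition i - rho <> j, over the integers, is written i <> rho + j. *)
Record balanced (rho : nat) (b : vspace_of V -> vspace_of V' -> K) : Prop :=
  Balanced {
  balanced_bilinear : bilinear_for *%R *%R b;
  balanced_neq0 : exists u v, b u v != 0;
  balanced_endpoint : (rho <= d - d')%N;
  balanced_B1 : forall (i : 'I_d.+1) (j : 'I_d'.+1) (u : V) (v : V'),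
    (i : nat) <> (rho + j)%N -> b (lEs Phi i *: u) (lEs Phi' j *: v) = 0;
  balanced_B2 : forall (i : 'I_d.+1) (j : 'I_d'.+1) (u : V) (v : V'),
    (i < j)%N \/ (i > j + (d - d'))%N -> b (lE Phi i *: u) (lE Phi' j *: v) = 0
}.

Definition descendent (rho : nat) : Prop := exists b, balanced rho b.

End Balanced.

Arguments balanced {K d d' A A'} V V' Phi Phi' rho b.
Arguments descendent {K d d' A A'} V V' Phi Phi' rho.

(* Main.v *)
From HB Require Import structures.
Require Import Defs.
From mathcomp Require Import all_boot all_order all_algebra.
From mathcomp Require Import boolp zify.

Set Implicit Arguments.
Unset Strict Implicit.
Unset Printing Implicit Defensive.

Import GRing.Theory.
Local Open Scope ring_scope.

(** Write [A], [As] for the pair of operators on [V] and [A'], [As'] for the pair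
    on [V']. Let [z] span the last eigenspace of [A] and [z0] the first one, and
    let [y] and [y0] do the same for [A']. Tridiagonality makes each of these
    vectors cyclic for the dual operator: the vectors [p.[As] z0] with
    [deg p <= i] fill the sum of the first [i + 1] eigenspaces of [A], and the
    vectors [p.[As] z] with [deg p <= i] the sum of the last [i + 1]
    ([split_flag_vector]). All components of these vectors in the eigenspaces of
    the dual operators are nonzero.

    By the first condition on balanced forms, such a form only pairs the
    eigenspace [rho + j] of [As] with the eigenspace [j] of [As']. So it is given
    by the [d' + 1] weights [g j] that pair the components of [z0] and [y], and
      [b (p.[As] z0) (q.[As'] y) = \sum_j g j * p.[t j] * q.[t' j]]
    with nodes [t j = ths (rho + j)] and [t' j = ths' j] ([balanced_expand]).
    The second condition says that such sums vanish for [deg p + deg q < d'],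
    both for the pair [z0], [y] and for the pair [z], [y0].

    A weight on [d' + 1] distinct nodes annihilates all polynomials of degree
    less than [d'] exactly when it is proportional to
    [1 / \prod_(k != j) (t j - t k)] ([weights_proportional],
    [node_weight_vanish]). This makes the form unique up to a scalar. Taking
    [q = 'X] for the pair [z0], [y] forces [t'] to be an affine function of [t]
    ([affine_of_vanish]), which is [cond_i]. Comparing the two pairs forces the
    ratio of the components of [y0] and [y] to be proportional to the ratio of
    the shifted components of [z0] and [z] ([balanced_ratio]). The ratio [r h] of
    the components of [z0] and [z] satisfies
    [r h = phi h.+1 / varphi h.+1 * r h.+1], as can be read off from the two
    split bases ([leonard_frame_exists]); so this second constraint is [cond_ii]
    ([ratio_condition]). Conversely, under [cond_i] and [cond_ii] the weights
    above define a balanced form ([built_form_balanced]). *)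

(** * Interpolation at distinct nodes *)

Section Interpolation.
Variables (K : fieldType) (n : nat) (t : 'I_n.+1 -> K).

Definition node_poly (i : 'I_n.+1) : {poly K} :=
  \prod_(j | j != i) ('X - (t j)%:P).

Definition node_weight (i : 'I_n.+1) : K := (node_poly i).[t i]^-1.

Definition lagrange_poly (i : 'I_n.+1) : {poly K} :=
  node_weight i *: node_poly i.

Lemma size_node_poly i : size (node_poly i) = n.+1.
Proof.
rewrite /node_poly -big_filter size_prod_XsubC size_filter -sum1_count.
by rewrite sum1_card cardC1 card_ord.
Qed.

Lemma size_lagrange_poly i : (size (lagrange_poly i) <= n.+1)%N.
Proof. by rewrite -(size_node_poly i) size_scale_leq. Qed.

Lemma coef_node_poly i : (node_poly i)`_n = 1.
Proof.
have /monicP : node_poly i \is monic by exact: monic_prod_XsubC.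
by rewrite lead_coefE size_node_poly.
Qed.

Lemma coef_lagrange_poly i : (lagrange_poly i)`_n = node_weight i.
Proof. by rewrite coefZ coef_node_poly mulr1. Qed.

Lemma node_poly_other i j : j != i -> (node_poly i).[t j] = 0.
Proof.
by move=> ji; rewrite horner_prod (bigD1 j) //= hornerXsubC subrr mul0r.
Qed.

Hypothesis t_inj : injective t.

Lemma node_poly_self i : (node_poly i).[t i] != 0.
Proof.
rewrite horner_prod; apply/prodf_neq0 => j ji.
by rewrite hornerXsubC subr_eq0 (inj_eq t_inj) eq_sym.
Qed.

Lemma node_weight_neq0 i : node_weight i != 0.
Proof. by rewrite invr_eq0 node_poly_self. Qed.

Lemma horner_lagrange_poly i j : (lagrange_poly i).[t j] = (i == j)%:R.
Proof.
rewrite hornerZ; case: eqVneq => [->|ij]; first by rewrite mulVf ?node_poly_self.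
by rewrite node_poly_other ?mulr0 // eq_sym.
Qed.

Lemma interpolation (p : {poly K}) : (size p <= n.+1)%N ->
  p = \sum_i p.[t i] *: lagrange_poly i.
Proof.
move=> sp; apply/eqP; rewrite -subr_eq0; apply/eqP.
apply: (@roots_geq_poly_eq0 _ _ [seq t i | i <- enum 'I_n.+1]).
- apply/allP => _ /mapP[j _ ->]; rewrite rootE hornerD hornerN horner_sum.
  rewrite (bigD1 j) //= hornerZ horner_lagrange_poly eqxx mulr1 big1 ?addr0 ?subrr //.
  by move=> i /negPf ij; rewrite hornerZ horner_lagrange_poly ij mulr0.
- by rewrite map_inj_uniq ?enum_uniq.
rewrite size_map size_enum_ord (leq_trans (size_polyD _ _)) // size_polyN.
rewrite geq_max sp (leq_trans (size_sum _ _ _)) //; apply/bigmax_leqP => i _.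
by rewrite (leq_trans (size_scale_leq _ _)) ?size_lagrange_poly.
Qed.

Lemma sum_lagrange_poly : \sum_i lagrange_poly i = 1.
Proof.
rewrite [RHS]interpolation ?size_poly1 //; apply: eq_bigr => i _.
by rewrite hornerC scale1r.
Qed.

(** The sum is the coefficient of degree [n] of the interpolation polynomial,
    that is, of [p] itself. *)
Lemma node_weight_vanish (p : {poly K}) : (size p <= n)%N ->
  \sum_i node_weight i * p.[t i] = 0.
Proof.
move=> sp.
have := congr1 (fun q : {poly K} => q`_n) (interpolation (leqW sp)).
rewrite nth_default // coef_sum => top; rewrite [RHS]top.
by apply: eq_bigr => i _; rewrite coefZ coef_lagrange_poly mulrC.
Qed.

Section Weights.
Variable g : 'I_n.+1 -> K.
Hypothesis g_vanish : forall p : {poly K}, (size p <= n)%N ->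
  \sum_i g i * p.[t i] = 0.

Lemma vanish_top_coef (p : {poly K}) : (size p <= n.+1)%N ->
  \sum_i g i * p.[t i] = p`_n * \sum_i g i * t i ^+ n.
Proof.
move=> sp; pose q := p - p`_n *: 'X^n.
have sq : (size q <= n)%N.
  apply/leq_sizeP => j; rewrite leq_eqVlt => /predU1P[<-|nj].
    by rewrite coefB coefZ coefXn eqxx mulr1 subrr.
  by rewrite coefB coefZ coefXn gtn_eqF // mulr0 subr0 nth_default ?(leq_trans sp).
apply/eqP; rewrite mulr_sumr -subr_eq0 -sumrB -[X in _ == X](g_vanish sq).
apply/eqP/eq_bigr => i _.
by rewrite hornerD hornerN hornerZ hornerXn mulrBr; congr (_ - _); rewrite mulrCA.
Qed.

(** Evaluating the functional at [node_poly i] isolates [g i], while this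
    polynomial is monic of degree [n]. *)
Lemma weights_proportional i :
  g i = (\sum_j g j * t j ^+ n) * node_weight i.
Proof.
have := vanish_top_coef (p := node_poly i).
rewrite size_node_poly coef_node_poly mul1r => <- //.
rewrite (bigD1 i) //= big1 ?addr0 ?mulfK ?node_poly_self //.
by move=> j ji; rewrite node_poly_other ?mulr0.
Qed.

(** If the interpolation polynomial of [s] had degree [m >= 2], its product with
    ['X^(n - m)] would have degree [n], so that its weighted sum could not
    vanish. *)
Lemma affine_of_vanish (s : 'I_n.+1 -> K) :
    (exists i, g i != 0) ->
    (forall p : {poly K}, (size p < n)%N -> \sum_i g i * s i * p.[t i] = 0) ->
  exists xi zeta : K, forall i, s i = xi * t i + zeta.
Proof.
move=> [i0 gi0] s_vanish.
pose r := \sum_i s i *: lagrange_poly i.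
have rE i : r.[t i] = s i.
  rewrite horner_sum (bigD1 i) //= hornerZ horner_lagrange_poly eqxx mulr1.
  rewrite big1 ?addr0 // => j /negPf ji.
  by rewrite hornerZ horner_lagrange_poly ji mulr0.
have sr : (size r <= n.+1)%N.
  rewrite (leq_trans (size_sum _ _ _)) //; apply/bigmax_leqP => i _.
  by rewrite (leq_trans (size_scale_leq _ _)) ?size_lagrange_poly.
have top_neq0 : \sum_i g i * t i ^+ n != 0.
  by apply: contra_neq gi0 => top0; rewrite weights_proportional top0 mul0r.
have [sr2|sr2] := leqP (size r) 2.
  exists r`_1, r`_0 => i; rewrite -rE (horner_coef_wide _ sr2).
  by rewrite !big_ord_recl big_ord0 /= expr0 mulr1 expr1 addr0 addrC.
have r_neq0 : r != 0 by rewrite -size_poly_gt0 (leq_trans _ sr2).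
pose m := (n.+1 - size r)%N.
have szq : size (r * 'X^m) = n.+1.
  by rewrite size_mulXn // /m subnK.
have : \sum_i g i * (r * 'X^m).[t i] = 0.
  rewrite -[RHS](s_vanish 'X^m); last first.
    by rewrite size_polyXn /m; lia.
  by apply: eq_bigr => i _; rewrite hornerM rE mulrA.
rewrite vanish_top_coef ?szq // => /eqP; rewrite mulf_eq0 (negPf top_neq0) orbF.
have -> : (r * 'X^m)`_n = lead_coef (r * 'X^m) by rewrite lead_coefE szq.
by rewrite lead_coef_eq0 mulf_eq0 (negPf r_neq0) -size_poly_eq0 size_polyXn.
Qed.

End Weights.

End Interpolation.

(** * Operators on a module over an algebra *)

Section Action.
Variables (K : fieldType) (A : algType K) (V : lmodType A).

Definition act (a : A) (v : vspace_of V) : vspace_of V := a *: (v : V).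

Lemma vscaleE (c : K) (v : vspace_of V) : c *: v = (c%:A : A) *: (v : V).
Proof. by []. Qed.

Fact act_is_linear a : linear (act a).
Proof.
move=> c u v; rewrite /act scalerDr; congr (_ + _).
by rewrite !vscaleE !scalerA -[in LHS]scalerAr mulr1 -scalerAl mul1r.
Qed.

HB.instance Definition _ a :=
  GRing.isLinear.Build K (vspace_of V) (vspace_of V) *:%R (act a)
    (act_is_linear a).

Lemma actM a b v : act (a * b) v = act a (act b v).
Proof. by rewrite /act scalerA. Qed.

Lemma act1 v : act 1 v = v.
Proof. by rewrite /act scale1r. Qed.

Lemma act0l v : act 0 v = 0.
Proof. by rewrite /act scale0r. Qed.

Lemma actDl a b v : act (a + b) v = act a v + act b v.
Proof. by rewrite /act scalerDl. Qed.

Lemma actZl c a v : act (c *: a) v = c *: act a v.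
Proof. by rewrite vscaleE /act scalerA -scalerAl mul1r. Qed.

Lemma act_suml I (r : seq I) (P : pred I) (F : I -> A) v :
  act (\sum_(i <- r | P i) F i) v = \sum_(i <- r | P i) act (F i) v.
Proof. by rewrite /act scaler_suml. Qed.

Definition pact (a : A) (p : {poly K}) (v : vspace_of V) : vspace_of V :=
  act (horner_alg a p) v.

Fact pact_is_linear a p : linear (pact a p).
Proof. exact: act_is_linear. Qed.

HB.instance Definition _ a p :=
  GRing.isLinear.Build K (vspace_of V) (vspace_of V) *:%R (pact a p)
    (pact_is_linear a p).

Lemma pactM a p q v : pact a (p * q) v = pact a p (pact a q v).
Proof. by rewrite /pact rmorphM actM. Qed.

Lemma pactC a c v : pact a c%:P v = c *: v.
Proof. by rewrite /pact horner_algC actZl act1. Qed.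

Lemma pact1 a v : pact a 1 v = v.
Proof. by rewrite pactC scale1r. Qed.

Lemma pact0 a v : pact a 0 v = 0.
Proof. by rewrite pactC scale0r. Qed.

Lemma pactX a v : pact a 'X v = act a v.
Proof. by rewrite /pact horner_algX. Qed.

Lemma pactDl a p q v : pact a (p + q) v = pact a p v + pact a q v.
Proof. by rewrite /pact rmorphD actDl. Qed.

Lemma pactZl a c p v : pact a (c *: p) v = c *: pact a p v.
Proof. by rewrite -mul_polyC pactM pactC. Qed.

Lemma pact_suml a I (r : seq I) (P : pred I) (F : I -> {poly K}) v :
  pact a (\sum_(i <- r | P i) F i) v = \sum_(i <- r | P i) pact a (F i) v.
Proof. by rewrite /pact raddf_sum act_suml. Qed.

Lemma pactXsubC a c v : pact a ('X - c%:P) v = act a v - c *: v.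
Proof. by rewrite pactDl pactX -polyCN pactC scaleNr. Qed.

Lemma pact_comm a p q v : pact a p (pact a q v) = pact a q (pact a p v).
Proof. by rewrite -!pactM mulrC. Qed.

Lemma pact_eigen a t p v : act a v = t *: v -> pact a p v = p.[t] *: v.
Proof.
move=> av; elim/poly_ind: p => [|p c IHp]; first by rewrite horner0 pact0 scale0r.
rewrite pactDl pactM pactX av linearZ /= IHp pactC hornerMXaddC.
by rewrite scalerA scalerDl mulrC.
Qed.

End Action.

(** * Primitive idempotents as interpolation polynomials *)

Section Spectral.
Variables (K : fieldType) (A : algType K) (V : lmodType A) (d : nat).

(** [e i] is the projection of a diagonalisable [a] onto its [t i]-eigenspace. *)
Record spectral (a : A) (t : nat -> K) (e : 'I_d.+1 -> A) : Prop := Spectral {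
  spectral_inj : injective (fun i : 'I_d.+1 => t i);
  spectral_sum : forall v : vspace_of V, \sum_i act (e i) v = v;
  spectral_orth : forall i j (v : vspace_of V),
    act (e i) (act (e j) v) = (i == j)%:R *: act (e j) v;
  spectral_poly : forall (i : 'I_d.+1) p (v : vspace_of V),
    act (e i) (pact a p v) = p.[t i] *: act (e i) v;
  spectral_eigen : forall (i : 'I_d.+1) (v : vspace_of V),
    act a (act (e i) v) = t i *: act (e i) v;
  spectral_id : forall (i : 'I_d.+1) (v : vspace_of V),
    act a v = t i *: v -> act (e i) v = v;
  spectral_neq0 : forall i, exists v : vspace_of V, act (e i) v != 0
}.

Definition annihilated (a : A) (t : nat -> K) : Prop :=
  forall v : vspace_of V, pact a (\prod_(i < d.+1) ('X - (t i)%:P)) v = 0.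

(** An eigenvalue is a root of any annihilating polynomial, so [d + 1] distinct
    eigenvalues exhaust the [d + 1] roots listed by [t]. *)
Lemma annihilated_inj a t : annihilated a t -> multiplicity_free d V a ->
  injective (fun i : 'I_d.+1 => t i).
Proof.
move=> kill [th th_inj th_eig].
have sub : {subset codom th <= codom (fun i : 'I_d.+1 => t i)}.
  move=> _ /codomP[i ->]; have [v v0 av] := th_eig i.
  have := kill v; rewrite (pact_eigen _ av) => /eqP.
  rewrite scaler_eq0 (negPf v0) orbF horner_prod => /prodf_eq0[j _].
  by rewrite hornerXsubC subr_eq0 => /eqP->; apply: codom_f.
apply/injectiveP; rewrite /injectiveb /dinjectiveb.
apply: (leq_size_uniq _ sub); first by rewrite map_inj_uniq ?enum_uniq.
by rewrite !size_map.
Qed.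

Lemma lagrange_poly_eigen a t i (v : vspace_of V) : annihilated a t ->
  let l := lagrange_poly (fun j : 'I_d.+1 => t j) i in
  act a (pact a l v) = t i *: pact a l v.
Proof.
move=> kill /=; apply/eqP; rewrite -subr_eq0 -pactXsubC -pactM /lagrange_poly.
have E : ('X - (t i)%:P) * node_poly (fun j : 'I_d.+1 => t j) i
    = \prod_(j < d.+1) ('X - (t j)%:P) by rewrite [RHS](bigD1 i).
by rewrite -scalerAr E pactZl kill scaler0.
Qed.

(** Both sides agree on each eigenspace, and the interpolation polynomials split
    every vector into eigenvectors. *)
Lemma idempotent_lagrange a t e : annihilated a t ->
    injective (fun i : 'I_d.+1 => t i) -> eigenvalue_sequence V a e t ->
  forall i (v : vspace_of V),
    act (e i) v = pact a (lagrange_poly (fun j : 'I_d.+1 => t j) i) v.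
Proof.
move=> kill t_inj eig i v; set l := lagrange_poly _.
have l_eig j := lagrange_poly_eigen j v kill.
have [_ e_id e_other] := eig i.
rewrite -{1}(pact1 a v) -(sum_lagrange_poly t_inj) pact_suml linear_sum.
rewrite (bigD1 i) //= -/l big1 ?addr0; first exact: (e_id _ (l_eig i)).
move=> j ji; apply: (e_other (t j)) (l_eig j).
by rewrite (inj_eq t_inj).
Qed.

Lemma spectral_intro a t e : annihilated a t -> multiplicity_free d V a ->
  eigenvalue_sequence V a e t -> spectral a t e.
Proof.
move=> kill mf eig; have t_inj := annihilated_inj kill mf.
have eE := idempotent_lagrange kill t_inj eig.
set l := lagrange_poly _ in eE.
have l_eig j (v : vspace_of V) : act a (act (e j) v) = t j *: act (e j) v.
  by rewrite eE lagrange_poly_eigen.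
split=> // [v|i j v|i p v|i v av|i].
- rewrite (eq_bigr _ (fun i _ => eE i v)).
  by rewrite -pact_suml sum_lagrange_poly ?pact1.
- by rewrite eE (pact_eigen _ (l_eig j v)) /l horner_lagrange_poly.
- by rewrite !eE pact_comm -eE (pact_eigen _ (l_eig i v)).
- by rewrite eE (pact_eigen _ av) /l horner_lagrange_poly // eqxx scale1r.
have [[v v0 av] e_id _] := eig i.
by exists v; have := e_id v av; rewrite /act => ->.
Qed.

Lemma eigenvalue_sequence_uniq a (e : 'I_d.+1 -> A) t1 t2 :
    eigenvalue_sequence V a e t1 -> eigenvalue_sequence V a e t2 ->
  forall i, (i <= d)%N -> t1 i = t2 i.
Proof.
move=> eig1 eig2 i le_id; pose i' : 'I_d.+1 := Ordinal (le_id : (i < d.+1)%N).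
have [[v v0 av] e_id _] := eig1 i'; have [_ _ e_other] := eig2 i'.
apply/eqP; apply: contraNT v0 => ne12.
by rewrite -(e_id v av) (e_other _ v ne12 av).
Qed.

End Spectral.

Arguments spectral {K A} V {d} a t e.
Arguments annihilated {K A} V d a t.

(** * Split bases *)

Section SplitBasis.
Variables (K : fieldType) (A : algType K) (V : lmodType A) (d : nat).
Implicit Types (u w : nat -> vspace_of V) (v : vspace_of V).

Definition span_on u (m n : nat) v : Prop :=
  exists c : nat -> K, v = \sum_(m <= j < n) c j *: u j.

(** Only [u 0, ..., u d] form the basis; setting [u d.+1 = 0] makes the action of
    [a] on [u d] an instance of the general rule. *)
Record split_basis (a s : A) (th ths x : nat -> K) u : Prop := SplitBasis {
  split_end : u d.+1 = 0;
  split_span : forall v, span_on u 0 d.+1 v;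
  split_low : forall j, (j <= d)%N -> act a (u j) = th j *: u j + u j.+1;
  split_up0 : act s (u 0%N) = ths 0%N *: u 0%N;
  split_up : forall j, (j < d)%N ->
    act s (u j.+1) = ths j.+1 *: u j.+1 + x j.+1 *: u j
}.

Section Span.
Variable u : nat -> vspace_of V.

Lemma span_ind (P : vspace_of V -> Prop) m n : P 0 ->
    (forall c v v', P v -> P v' -> P (c *: v + v')) ->
    (forall j, (m <= j < n)%N -> P (u j)) ->
  forall v, span_on u m n v -> P v.
Proof.
move=> P0 Plin Pu _ [c ->]; rewrite big_nat.
by elim/big_rec: _ => // j v mjn Pv; apply: Plin => //; apply: Pu.
Qed.

Lemma span0 m n : span_on u m n 0.
Proof. by exists (fun=> 0); rewrite big1 // => j _; rewrite scale0r. Qed.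

Lemma span_lin m n c v v' :
  span_on u m n v -> span_on u m n v' -> span_on u m n (c *: v + v').
Proof.
move=> [c1 ->] [c2 ->]; exists (fun j => c * c1 j + c2 j).
rewrite scaler_sumr -big_split /=; apply: eq_bigr => j _.
by rewrite scalerDl scalerA.
Qed.

Lemma spanZ m n c v : span_on u m n v -> span_on u m n (c *: v).
Proof. by move=> uv; rewrite -[_ *: _]addr0; apply: span_lin => //; apply: span0. Qed.

Lemma spanD m n v v' :
  span_on u m n v -> span_on u m n v' -> span_on u m n (v + v').
Proof. by move=> uv uv'; rewrite -[v]scale1r; apply: span_lin. Qed.

Lemma span_mem m n j : (m <= j < n)%N -> span_on u m n (u j).
Proof.
move=> mjn; exists (fun i => (i == j)%:R).
rewrite (bigD1_seq j) ?mem_index_iota ?iota_uniq //= eqxx scale1r.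
by rewrite big1 ?addr0 // => i /negPf->; rewrite scale0r.
Qed.

Lemma span_sub m n m' n' v : (m' <= m)%N -> (n <= n')%N ->
  span_on u m n v -> span_on u m' n' v.
Proof.
move=> mm nn; apply: (span_ind (P := span_on u m' n'))
  => [|c v1 v2|j mjn]; first exact: span0.
  exact: span_lin.
by apply: span_mem; lia.
Qed.

End Span.

Section OneBasis.
Variables (a s : A) (th ths x : nat -> K) (u : nat -> vspace_of V).
Hypothesis ub : split_basis a s th ths x u.

Lemma span_empty m n v : (n <= m)%N -> span_on u m n v -> v = 0.
Proof. by move=> nm [c ->]; rewrite big_geq. Qed.

Lemma tail_next m j : (m <= j.+1)%N -> (j <= d)%N -> span_on u m d.+1 (u j.+1).
Proof.
move=> mj; rewrite leq_eqVlt => /predU1P[->|jd].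
  by rewrite (split_end ub); apply: span0.
by apply: span_mem; lia.
Qed.

Lemma tail_low_step m v : (m <= d)%N -> span_on u m d.+1 v ->
  span_on u m.+1 d.+1 (pact a ('X - (th m)%:P) v).
Proof.
move=> md.
apply: (span_ind
  (P := fun v => span_on u m.+1 d.+1 (pact a ('X - (th m)%:P) v))) => [|c v1 v2|j jP].
- by rewrite linear0; apply: span0.
- by rewrite linearP; apply: span_lin.
rewrite pactXsubC (split_low ub); last by lia.
have [->|mj] := eqVneq j m.
  by rewrite addrC addKr; apply: tail_next.
rewrite addrAC -scalerBl; apply: span_lin; last by apply: tail_next; lia.
by apply: span_mem; lia.
Qed.

Lemma tail_low_prod m v : (m <= d.+1)%N ->
  span_on u m d.+1 (pact a (\prod_(i < m) ('X - (th i)%:P)) v).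
Proof.
elim: m => [|m IHm] md; first by rewrite big_ord0 pact1; apply: (split_span ub).
rewrite big_ord_recr /= mulrC pactM.
by apply: tail_low_step => //; apply: IHm; apply: ltnW.
Qed.

Lemma split_annihilated_low : annihilated V d a th.
Proof. by move=> v; apply: (@span_empty d.+1 d.+1) => //; apply: tail_low_prod. Qed.

Lemma head_low m v : (m <= d)%N -> span_on u 0 m v -> span_on u 0 m.+1 (act a v).
Proof.
move=> md.
apply: (span_ind (P := fun v => span_on u 0 m.+1 (act a v))) => [|c v1 v2|j jP].
- by rewrite linear0; apply: span0.
- by rewrite linearP; apply: span_lin.
rewrite (split_low ub); last by lia.
by apply: span_lin; apply: span_mem; lia.
Qed.

Lemma head_up_step m v : (m <= d)%N -> span_on u 0 m.+1 v ->
  span_on u 0 m (pact s ('X - (ths m)%:P) v).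
Proof.
move=> md.
apply: (span_ind
  (P := fun v => span_on u 0 m (pact s ('X - (ths m)%:P) v))) => [|c v1 v2|[|j] jP].
- by rewrite linear0; apply: span0.
- by rewrite linearP; apply: span_lin.
- rewrite pactXsubC (split_up0 ub) -scalerBl; have [->|m0] := eqVneq m 0%N.
    by rewrite subrr scale0r; apply: span0.
  by apply: spanZ; apply: span_mem; lia.
rewrite pactXsubC (split_up ub); last by lia.
rewrite addrAC -scalerBl; have [<-|mj] := eqVneq j.+1 m.
  by rewrite subrr scale0r add0r; apply: spanZ; apply: span_mem; lia.
by apply: span_lin; [|apply: spanZ]; apply: span_mem; lia.
Qed.

Lemma head_up_prod m v : (m <= d.+1)%N -> span_on u 0 m v ->
  pact s (\prod_(i < m) ('X - (ths i)%:P)) v = 0.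
Proof.
elim: m v => [|m IHm] v md vm; first by rewrite (span_empty _ vm) ?linear0.
by rewrite big_ord_recr /= pactM IHm ?(ltnW md) //; apply: head_up_step.
Qed.

Lemma split_annihilated_up : annihilated V d s ths.
Proof. by move=> v; apply: head_up_prod => //; apply: (split_span ub). Qed.

Lemma tail_up m v : (m < d.+1)%N -> span_on u m.+1 d.+1 v ->
  span_on u m d.+1 (act s v).
Proof.
move=> md.
apply: (span_ind (P := fun v => span_on u m d.+1 (act s v))) => [|c v1 v2|[|j] jP //].
- by rewrite linear0; apply: span0.
- by rewrite linearP; apply: span_lin.
rewrite (split_up ub); last by lia.
by apply: span_lin; [|apply: spanZ]; apply: span_mem; lia.
Qed.

Variables (E Es : 'I_d.+1 -> A).
Hypothesis Esp : spectral V a th E.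
Hypothesis Essp : spectral V s ths Es.
Hypothesis E_next : forall i j : 'I_d.+1, j = i.+1 :> nat ->
  exists v : vspace_of V, act (E i) (act s (act (E j) v)) != 0.

(** The vector is an eigenvector of the product in [tail_low_prod], whose roots
    [th 0, ..., th (i - 1)] all differ from [th i]. *)
Lemma idempotent_tail (i : 'I_d.+1) v : span_on u i d.+1 (act (E i) v).
Proof.
have := tail_low_prod (act (E i) v) (ltnW (ltn_ord i)).
rewrite (pact_eigen _ (spectral_eigen Esp i v)).
set c := _.[_]; have c0 : c != 0.
  rewrite /c horner_prod; apply/prodf_neq0 => j _; rewrite hornerXsubC subr_eq0.
  have jd : (j < d.+1)%N by apply: ltn_trans (ltn_ord i).
  have := inj_eq (spectral_inj Esp) i (Ordinal jd); rewrite -val_eqE /= => ->.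
  by rewrite gtn_eqF.
by move/(spanZ c^-1); rewrite scalerA mulVf ?scale1r.
Qed.

(** The tail is generated from [u i] by the operators [a - th j] with [j >= i],
    and the first of them vanishes on the range of [E i]. *)
Lemma idempotent_kills_tail (i : 'I_d.+1) v :
  span_on u i.+1 d.+1 v -> act (E i) v = 0.
Proof.
apply: (span_ind (P := fun v => act (E i) v = 0)) => [|c v1 v2 v10 v20|j].
- by rewrite linear0.
- by rewrite linearP /= v10 v20 scaler0 addr0.
elim: j => // j IHj jP.
have uE : u j.+1 = pact a ('X - (th j)%:P) (u j).
  by rewrite pactXsubC (split_low ub) ?[_ + u j.+1]addrC ?addrK //; lia.
rewrite uE (spectral_poly Esp) hornerXsubC.
have [<-|ij] := eqVneq (i : nat) j; first by rewrite subrr scale0r.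
by rewrite IHj ?scaler0 //; lia.
Qed.

(** If [x k] vanished, [u k, ..., u d] would span an [s]-invariant subspace, so
    that [E (k - 1) * s * E k] would vanish. *)
Lemma split_neq0 k : (1 <= k <= d)%N -> x k != 0.
Proof.
case: k => [//|k] kd; apply/eqP => xk0.
have kd1 : (k < d.+1)%N by lia.
have kd2 : (k.+1 < d.+1)%N by lia.
have [v] := @E_next (Ordinal kd1) (Ordinal kd2) erefl.
rewrite idempotent_kills_tail ?eqxx //=.
apply: (span_ind (P := fun v => span_on u k.+1 d.+1 (act s v)) _ _ _
  (idempotent_tail (Ordinal kd2) v)) => [|c v1 v2|[|j] //= jP].
- by rewrite linear0; apply: span0.
- by rewrite linearP; apply: span_lin.
rewrite (split_up ub); last by lia.
have [->|jk] := eqVneq j k.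
  by rewrite xk0 scale0r addr0; apply: spanZ; apply: span_mem; lia.
by apply: span_lin; [|apply: spanZ]; apply: span_mem; lia.
Qed.

(** As [x k] is invertible, [u (k - 1)] is a multiple of [(s - ths k) (u k)]. *)
Lemma tail_basis_poly m : (m <= d)%N ->
  exists2 p : {poly K}, (size p <= m.+1)%N & u (d - m)%N = pact s p (u d).
Proof.
elim: m => [|m IHm] md.
  by exists 1; rewrite ?size_poly1 // pact1 subn0.
have [p sp up] := IHm (ltnW md).
pose k := (d - m.+1)%N; have kE : (d - m)%N = k.+1 by rewrite /k; lia.
have xk : x k.+1 != 0 by apply: split_neq0; rewrite /k; lia.
exists ((x k.+1)^-1 *: (('X - (ths k.+1)%:P) * p)).
  rewrite (leq_trans (size_scale_leq _ _)) // (leq_trans (size_polyMleq _ _)) //.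
  by rewrite size_XsubC.
rewrite pactZl pactM -up kE pactXsubC (split_up ub); last by rewrite /k; lia.
by rewrite [_ + x _ *: _]addrC addrK scalerA mulVf ?scale1r.
Qed.

Lemma tail_poly m v : (m <= d)%N -> span_on u (d - m) d.+1 v ->
  exists2 p : {poly K}, (size p <= m.+1)%N & v = pact s p (u d).
Proof.
move=> md.
apply: (span_ind (P := fun v =>
  exists2 p : {poly K}, (size p <= m.+1)%N & v = pact s p (u d)))
  => [|c v1 v2 [p1 sp1 ->] [p2 sp2 ->]|j jP].
- by exists 0; rewrite ?size_poly0 // pact0.
- exists (c *: p1 + p2); last by rewrite pactDl pactZl.
  rewrite (leq_trans (size_polyD _ _)) // geq_max sp2 andbT.
  by rewrite (leq_trans (size_scale_leq _ _)).
have [|p sp] := @tail_basis_poly (d - j)%N; first by lia.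
rewrite subKn; last by lia.
by exists p => //; lia.
Qed.

Lemma poly_tail m (p : {poly K}) : (m <= d)%N -> (size p <= m.+1)%N ->
  span_on u (d - m) d.+1 (pact s p (u d)).
Proof.
elim/poly_ind: p m => [|p c IHp] m md; first by rewrite pact0 => _; apply: span0.
have [->|p0] := eqVneq p 0.
  rewrite mul0r add0r pactC => _; apply: spanZ; apply: span_mem; lia.
rewrite size_MXaddC (negPf p0) /= => sp.
have pm : (size p <= m)%N by [].
have m0 : (0 < m)%N by rewrite (leq_trans _ pm) ?size_poly_gt0.
rewrite pactDl mulrC pactM pactX pactC addrC.
apply: span_lin; first by apply: span_mem; lia.
apply: tail_up; first by lia.
have -> : (d - m).+1 = (d - m.-1)%N by lia.
by apply: IHp; lia.
Qed.

(** [z] spans an eigenspace at one end of the ordering [E]: the vectors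
    [pact s p z] with [size p <= m.+1] fill the sum of the last [m + 1] spaces
    [act (E i) V]. *)
Record flag_vector z : Prop := FlagVector {
  flag_cyclic : forall v, exists p, v = pact s p z;
  flag_poly : forall (i : 'I_d.+1) v,
    exists2 p : {poly K}, (size p <= (d - i).+1)%N & act (E i) v = pact s p z;
  flag_kill : forall (i : 'I_d.+1) (p : {poly K}), (size p <= d - i)%N ->
    act (E i) (pact s p z) = 0
}.

Lemma split_flag_vector : flag_vector (u d).
Proof.
split=> [v|i v|i p].
- have [||p _ ->] := @tail_poly d v; rewrite ?subnn //; last by exists p.
  exact: (split_span ub).
- have id := ltn_ord i; apply: tail_poly; first exact: leq_subr.
  by rewrite subKn; [apply: idempotent_tail | lia].
have id := ltn_ord i; have [->|i_d] := eqVneq (i : nat) d.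
  by rewrite subnn leqn0 size_poly_eq0 => /eqP->; rewrite pact0 linear0.
have -> : (d - i)%N = (d - i.+1).+1 by lia.
move=> sp; apply: idempotent_kills_tail.
have -> : i.+1 = (d - (d - i.+1))%N by lia.
by apply: poly_tail => //; lia.
Qed.

(** Comparison of the [ths h]-components in
    [s (u k.+1) = ths k.+1 *: u k.+1 + x k.+1 *: u k]. *)
Lemma up_coord (h : 'I_d.+1) k : (k < d)%N ->
  (ths h - ths k.+1) *: act (Es h) (u k.+1) = x k.+1 *: act (Es h) (u k).
Proof.
move=> kd; rewrite -hornerXsubC -(spectral_poly Essp) pactXsubC (split_up ub) //.
by rewrite [_ + x _ *: _]addrC addrK linearZ.
Qed.

Lemma up_coord_top (h : 'I_d.+1) :
  (\prod_(h.+1 <= k < d.+1) (ths h - ths k)) *: act (Es h) (u d) =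
  (\prod_(h.+1 <= k < d.+1) x k) *: act (Es h) (u h).
Proof.
suff G n : (n <= d)%N -> (h <= n)%N ->
    (\prod_(h.+1 <= k < n.+1) (ths h - ths k)) *: act (Es h) (u n) =
    (\prod_(h.+1 <= k < n.+1) x k) *: act (Es h) (u h).
  by apply: G => //; rewrite -ltnS.
elim: n => [|n IHn] nd; first by rewrite leqn0 => /eqP h0; rewrite h0 !big_geq.
rewrite leq_eqVlt => /predU1P[hn|hn]; first by rewrite hn !big_geq.
rewrite 2?(big_nat_recr n.+1) //= -!scalerA up_coord //.
have swap b c v : b *: (c *: v) = c *: (b *: v) by rewrite !scalerA mulrC.
by rewrite swap IHn ?(ltnW nd) // swap.
Qed.

Lemma up_coord_head (h : 'I_d.+1) v : span_on u 0 h v -> act (Es h) v = 0.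
Proof.
apply: (span_ind (P := fun v => act (Es h) v = 0)) => [|c v1 v2 v10 v20|j].
- by rewrite linear0.
- by rewrite linearP /= v10 v20 scaler0 addr0.
have hd := ltn_ord h.
have neq0 k : (k < h)%N -> ths h - ths k != 0.
  move=> kh; rewrite subr_eq0; have kd : (k < d.+1)%N by apply: ltn_trans hd.
  have := inj_eq (spectral_inj Essp) h (Ordinal kd); rewrite -val_eqE /= => ->.
  by rewrite gtn_eqF.
elim: j => [|j IHj] jh.
  apply: (scalerI (neq0 _ jh)); rewrite scaler0.
  rewrite -hornerXsubC -(spectral_poly Essp) pactXsubC (split_up0 ub).
  by rewrite subrr linear0.
apply: (scalerI (neq0 _ jh)); rewrite scaler0 up_coord; last by lia.
by rewrite IHj ?scaler0 //; lia.
Qed.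

Lemma split_start_neq0 : u 0%N != 0.
Proof.
have [v] := spectral_neq0 Esp ord0; apply: contraNneq => u00.
have uj j : (j <= d)%N -> u j = 0.
  elim: j => // j IHj jd; have := split_low ub (ltnW jd).
  by rewrite IHj ?(ltnW jd) // linear0 scaler0 add0r => <-.
suff -> : v = 0 by rewrite linear0.
have := split_span ub v; apply: (span_ind (P := fun v => v = 0)) => //.
  by move=> c v1 v2 -> ->; rewrite scaler0 addr0.
Qed.

End OneBasis.

(** The vectors [u h] and [w h] are obtained from [u 0] and [w 0], which lie on
    the same line, by monic polynomials of degree [h] in [a]; so [w h] and
    [c *: u h] differ by a combination of [u 0, ..., u (h - 1)], which [Es h]
    kills. *)
Lemma up_coord_diag a s th th2 ths x y u w (E Es : 'I_d.+1 -> A) :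
    split_basis a s th ths x u -> split_basis a s th2 ths y w ->
    spectral V a th E -> spectral V a th2 (fun i => E (rev_ord i)) ->
    spectral V s ths Es ->
    (exists z, forall v, exists p, v = pact s p z) ->
  exists2 c : K, c != 0 & forall h : 'I_d.+1,
    act (Es h) (w h) = c *: act (Es h) (u h).
Proof.
move=> ub wb Esp Esp2 Essp [z cyc].
have eigen_line v : act s v = ths 0%N *: v -> exists c : K, v = c *: act (Es ord0) z.
  move=> sv; have [p vE] := cyc v; exists p.[ths 0%N].
  by rewrite -(spectral_poly Essp ord0) -vE (spectral_id Essp (i := ord0) sv).
have [c1 uE] := eigen_line _ (split_up0 ub).
have [c2 wE] := eigen_line _ (split_up0 wb).
have u0 := split_start_neq0 ub Esp; have w0 := split_start_neq0 wb Esp2.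
have c10 : c1 != 0 by apply: contraNneq u0 => c0; rewrite uE c0 scale0r.
have c20 : c2 != 0 by apply: contraNneq w0 => c0; rewrite wE c0 scale0r.
exists (c2 / c1) => [|h]; first by rewrite mulf_neq0 ?invr_eq0.
set c := c2 / c1.
have diff j : (j <= d)%N -> span_on u 0 j (w j - c *: u j).
  elim: j => [|j IHj] jd.
    rewrite wE uE scalerA divfK // subrr; exact: span0.
  have jd' := ltnW jd; have uj := split_low ub jd'; have wj := split_low wb jd'.
  set r := w j - c *: u j in IHj.
  have wr : w j = r + c *: u j by rewrite subrK.
  have -> : w j.+1 - c *: u j.+1 =
      pact a ('X - (th2 j)%:P) r + (c * (th j - th2 j)) *: u j.
    rewrite /r [pact _ _ _]linearB /= [pact _ _ (c *: _)]linearZ /= !pactXsubC wj uj.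
    rewrite [th2 j *: w j + _ - _]addrAC subrr add0r.
    rewrite [th j *: _ + _ - _]addrAC -scalerBl scalerDr scalerA.
    by rewrite opprD addrA [RHS]addrAC subrK.
  apply: spanD; last by apply: spanZ; apply: span_mem; lia.
  rewrite pactXsubC -scaleNr addrC; apply: span_lin.
    by apply: span_sub (IHj jd').
  by apply: (head_low ub) => //; apply: IHj.
have hd : (h <= d)%N by rewrite -ltnS.
have := up_coord_head ub Essp (diff h hd).
by rewrite linearB linearZ /= => /eqP; rewrite subr_eq0 => /eqP.
Qed.

End SplitBasis.

(** * Irreducible modules over a matrix algebra *)

Section MatrixModule.
Variables (K : fieldType) (A : algType K) (V : lmodType A) (d : nat).
Variable f : {lrmorphism A -> 'M[K]_d.+1}.
Hypothesis f_bij : bijective f.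

Lemma matrix_units : exists e : 'I_d.+1 -> 'I_d.+1 -> A,
  [/\ \sum_i e i i = 1,
      forall i j k l, e i j * e k l = (j == k)%:R *: e i l
    & forall a i j, a * e i j = \sum_k f a k i *: e k j].
Proof.
have [g fK gK] := f_bij; have f_inj := can_inj fK.
exists (fun i j => g (delta_mx i j)).
split=> [|i j k l|a i j]; apply: f_inj.
- rewrite raddf_sum rmorph1 /=; under eq_bigr do rewrite gK.
  by rewrite -[RHS]/(1%:M) mx1_sum_delta.
- rewrite rmorphM linearZ /= !gK -mulmxE mul_delta_mx_cond.
  by case: eqP; rewrite ?scale1r ?scale0r.
rewrite rmorphM raddf_sum /= gK; under eq_bigr do rewrite linearZ /= gK.
apply/matrixP => r c; rewrite !mxE summxE (bigD1 i) //= mxE eqxx /=.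
rewrite big1 ?addr0; last by move=> k ki; rewrite mxE (negPf ki) mulr0.
rewrite (bigD1 r) //= !mxE eqxx big1 ?addr0 // => k kr.
by rewrite !mxE eq_sym (negPf kr) mulr0.
Qed.

Hypothesis V_irr : irreducible_module V.

(** The vectors [e j i v], for matrix units [e j i] and some [v] with
    [e i i v != 0], transform like the standard column vectors; they span a
    nonzero submodule. *)
Lemma matrix_basis : exists m : 'I_d.+1 -> vspace_of V,
  [/\ forall a j, act a (m j) = \sum_k f a k j *: m k,
      forall v, exists c : 'I_d.+1 -> K, v = \sum_j c j *: m j
    & forall c : 'I_d.+1 -> K, \sum_j c j *: m j = 0 -> forall j, c j = 0].
Proof.
have [e [e1 eM fe]] := matrix_units; have [[v0 v0_neq0] irr] := V_irr.
have [i ei] : exists i, act (e i i) (v0 : vspace_of V) != 0.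
  apply/existsP; apply: contraNT v0_neq0; rewrite negb_exists => /forallP e0.
  rewrite -[v0](@act1 _ _ V) -e1 act_suml big1 // => i _.
  by apply/eqP; rewrite -[_ == _]negbK.
pose m j : vspace_of V := act (e j i) v0.
have am a j : act a (m j) = \sum_k f a k j *: m k.
  by rewrite -actM fe act_suml; apply: eq_bigr => k _; rewrite actZl.
exists m; split=> // [|c c0 j]; last first.
  have /eqP := congr1 (act (e i j)) c0; rewrite linear0 linear_sum (bigD1 j) //=.
  rewrite big1 ?addr0 => [|k /negPf kj].
    rewrite linearZ /= -actM eM eqxx scale1r scaler_eq0 (negPf ei) orbF.
    by move/eqP.
  by rewrite linearZ /= -actM eM eq_sym kj scale0r act0l scaler0.
pose W : {pred V} := fun v => `[< exists c : 'I_d.+1 -> K, v = \sum_j c j *: m j >].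
have W_m j : m j \in W.
  apply/asboolP; exists (fun k => (k == j)%:R); rewrite (bigD1 j) //= eqxx scale1r.
  by rewrite big1 ?addr0 // => k /negPf->; rewrite scale0r.
have W_sub : submod_closed W.
  split.
    by apply/asboolP; exists (fun=> 0); rewrite big1 // => j _; rewrite scale0r.
  move=> a _ _ /asboolP[c1 ->] /asboolP[c2 ->]; apply/asboolP.
  exists (fun k => \sum_j c1 j * f a k j + c2 k).
  rewrite -[a *: _]/(act a _) linear_sum /=.
  under [RHS]eq_bigr do rewrite scalerDl scaler_suml.
  rewrite big_split /= exchange_big /=; congr (_ + _); apply: eq_bigr => j _.
  rewrite linearZ /= am scaler_sumr; apply: eq_bigr => k _.
  by rewrite scalerA.
have [W0|WT] := irr W W_sub; last by move=> v; apply/asboolP/WT.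
by have /eqP := W0 _ (W_m i); rewrite (negPf ei).
Qed.

Lemma matrix_faithful a : (forall v : vspace_of V, act a v = 0) -> a = 0.
Proof.
have [m [am _ m_free]] := matrix_basis; move=> a0.
apply: (bij_inj f_bij); rewrite linear0; apply/matrixP => k j; rewrite mxE.
by apply: (m_free (fun k => f a k j)); rewrite -am.
Qed.

Lemma matrix_split_basis a s th ths x :
    f a = lower_bidiagonal d th -> f s = upper_bidiagonal d ths x ->
  exists u : nat -> vspace_of V, split_basis d a s th ths x u.
Proof.
move=> fa fs; have [m [am m_span _]] := matrix_basis.
pose u j : vspace_of V := if (j <= d)%N then m (inord j) else 0.
have um (j : 'I_d.+1) : u j = m j by rewrite /u -ltnS ltn_ord inord_val.
exists u; split=> [|v|j jd||j jd].
- by rewrite /u ltnn.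
- have [c ->] := m_span v; exists (fun j => c (inord j)).
  by rewrite big_mkord; apply: eq_bigr => j _; rewrite um inord_val.
- pose j' : 'I_d.+1 := Ordinal (jd : (j < d.+1)%N).
  rewrite -[j]/(val j') um am fa (bigD1 j') //= !mxE eqxx; congr (_ + _).
  have [jd1|jd1] := ltnP j d; last first.
    rewrite /u leqNgt ltnS jd1 /= big1 // => k kj; rewrite mxE (negPf kj).
    by rewrite ltn_eqF ?scale0r // (leq_trans (ltn_ord k)).
  pose k' : 'I_d.+1 := Ordinal (jd1 : (j.+1 < d.+1)%N).
  rewrite -[j.+1]/(val k') um (bigD1 k') //=; last by rewrite -val_eqE /= gtn_eqF.
  rewrite !mxE -val_eqE /= gtn_eqF // eqxx scale1r big1 ?addr0 // => k /andP[kj kk].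
  by rewrite mxE (negPf kj) (negPf (kk : (k : nat) != j.+1)) scale0r.
- rewrite -[0%N]/(val (@ord0 d)) um am fs (bigD1 ord0) //= !mxE eqxx.
  by rewrite big1 ?addr0 // => k /negPf k0; rewrite mxE k0 scale0r.
have jd1 : (j < d.+1)%N by apply: ltnW.
pose j' : 'I_d.+1 := Ordinal jd1.
pose k' : 'I_d.+1 := Ordinal (jd : (j.+1 < d.+1)%N).
rewrite -[j.+1]/(val k') -[j]/(val j') !um am fs (bigD1 k') //= !mxE eqxx.
congr (_ + _); rewrite (bigD1 j') //=; last by rewrite -val_eqE /= ltn_eqF.
rewrite !mxE -val_eqE /= ltn_eqF // eqxx big1 ?addr0 // => k /andP[kk kj].
rewrite mxE (negPf kk) eqSS eq_sym (negPf (kj : (k : nat) != j)) scale0r //.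
Qed.

End MatrixModule.

(** * The two end vectors of a Leonard system *)

Section LeonardFrame.
Variables (K : fieldType) (A : algType K) (V : lmodType A) (d : nat).
Lemma leonard_split_basis (Phi : leonard_data A d) x th ths : irreducible_module V ->
    split_sequence V Phi x ->
    eigenvalue_sequence V (lA Phi) (lE Phi) th ->
    eigenvalue_sequence V (lAs Phi) (lEs Phi) ths ->
  exists u : nat -> vspace_of V, split_basis d (lA Phi) (lAs Phi) th ths x u.
Proof.
move=> V_irr [th1 [ths1 [eig1 eigs1 [f [f_bij fA fAs]]]]] eig eigs.
apply: (matrix_split_basis f_bij V_irr); [rewrite fA | rewrite fAs];
  apply/matrixP => i j; rewrite !mxE; case: ifP => // _.
- by rewrite (eigenvalue_sequence_uniq eig1 eig) // -ltnS.
- by rewrite (eigenvalue_sequence_uniq eigs1 eigs) // -ltnS.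
Qed.

Variable Phi : leonard_data A d.

(** [z] spans [act (lE Phi ord_max) V] and [z0] spans [act (lE Phi ord0) V]; [r]
    compares their components in the eigenspaces of [lAs Phi]. *)
Record leonard_frame (varphi phi : nat -> K) (z z0 : vspace_of V)
    (r : nat -> K) : Prop := LeonardFrame {
  frame_last : flag_vector (lAs Phi) (lE Phi) z;
  frame_first : flag_vector (lAs Phi) (fun i => lE Phi (rev_ord i)) z0;
  frame_varphi_neq0 : forall k, (1 <= k <= d)%N -> varphi k != 0;
  frame_phi_neq0 : forall k, (1 <= k <= d)%N -> phi k != 0;
  frame_ratio : forall h : 'I_d.+1,
    act (lEs Phi h) z0 = r h *: act (lEs Phi h) z;
  frame_ratio_neq0 : forall h, (h <= d)%N -> r h != 0;
  frame_ratio_step : forall h, (h < d)%N -> r h = phi h.+1 / varphi h.+1 * r h.+1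
}.

Variables th ths varphi phi : nat -> K.
Hypothesis Phi_leonard : leonard_system V Phi.
Hypothesis Phi_param : parameter_array V Phi th ths varphi phi.

(** Reversing the order of the [lE Phi i] reverses [th] and replaces [varphi] by
    [phi]. *)
Lemma leonard_bases : exists u w : nat -> vspace_of V,
  split_basis d (lA Phi) (lAs Phi) th ths varphi u /\
  split_basis d (lA Phi) (lAs Phi) (fun j => th (d - j)%N) ths phi w.
Proof.
case: Phi_param => eig eigs sp1 sp2; have V_irr := leonard_module Phi_leonard.
have [u ub] := leonard_split_basis V_irr sp1 eig eigs.
have [|w wb] := leonard_split_basis V_irr sp2 (th := fun j => th (d - j)%N) _ eigs.
  move=> i; have := eig (rev_ord i).
  by rewrite /= subSS.
by exists u, w.
Qed.

Lemma leonard_spectral : spectral V (lA Phi) th (lE Phi).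
Proof.
have [u [_ [ub _]]] := leonard_bases; case: Phi_param => eig _ _ _.
apply: spectral_intro (leonard_mfA Phi_leonard) eig.
exact: split_annihilated_low ub.
Qed.

Lemma leonard_spectral_dual : spectral V (lAs Phi) ths (lEs Phi).
Proof.
have [u [_ [ub _]]] := leonard_bases; case: Phi_param => _ eigs _ _.
apply: spectral_intro (leonard_mfAs Phi_leonard) eigs.
exact: split_annihilated_up ub.
Qed.

Lemma spectral_rev a t (e : 'I_d.+1 -> A) : spectral V a t e ->
  spectral V a (fun j => t (d - j)%N) (fun i => e (rev_ord i)).
Proof.
move=> sp; have revE (i : 'I_d.+1) : (d - i)%N = rev_ord i by rewrite /= subSS.
split=> [i j|v|i j v|i p v|i v|i v|i]; rewrite ?revE.
- by move=> tij; apply: rev_ord_inj; apply: (spectral_inj sp) tij.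
- rewrite (reindex_inj rev_ord_inj) /= -[RHS](spectral_sum sp).
  by apply: eq_bigr => i _; rewrite rev_ordK.
- by rewrite (spectral_orth sp) (inj_eq rev_ord_inj).
- exact: (spectral_poly sp).
- exact: (spectral_eigen sp).
- exact: (spectral_id sp).
- exact: (spectral_neq0 sp).
Qed.

(** The module is faithful, so that a nonzero product acts nontrivially. *)
Lemma tridiagonal_act (i j : 'I_d.+1) : `|i%:Z - j%:Z| = 1 ->
  exists v : vspace_of V,
    act (lE Phi i) (act (lAs Phi) (act (lE Phi j) v)) != 0.
Proof.
move=> ij1; have [_ /(_ ij1)] := leonard_As_tridiag Phi_leonard i j.
have [f f_bij] := leonard_algebra Phi_leonard => /eqP neq0.
apply: contrapT => no_v; apply: neq0.
apply: (matrix_faithful f_bij (leonard_module Phi_leonard)) => v.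
rewrite !actM; apply/eqP/negPn/negP => v_neq0; apply: no_v.
by exists v.
Qed.

(** The end vectors of the two split bases have, in the eigenspace [h] of
    [lAs Phi], the component of the [h]-th basis vector multiplied by
    [\prod_(h < k <= d) varphi k / (ths h - ths k)], respectively by the same
    product with [phi]. The denominators cancel in the ratio, and the components
    of the [h]-th basis vectors are related by a constant ([up_coord_diag]). *)
Lemma leonard_frame_exists : exists z z0 r, leonard_frame varphi phi z z0 r.
Proof.
have [u [w [ub wb]]] := leonard_bases.
have Esp := leonard_spectral; have Essp := leonard_spectral_dual.
have Esp2 := spectral_rev Esp.
have next (i j : 'I_d.+1) : j = i.+1 :> nat -> exists v : vspace_of V,
    act (lE Phi i) (act (lAs Phi) (act (lE Phi j) v)) != 0.
  by move=> ji; apply: tridiagonal_act; rewrite ji; lia.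
have next2 (i j : 'I_d.+1) : j = i.+1 :> nat -> exists v : vspace_of V,
    act (lE Phi (rev_ord i)) (act (lAs Phi) (act (lE Phi (rev_ord j)) v)) != 0.
  move=> ji; apply: tridiagonal_act; have := ltn_ord j.
  by rewrite /= ji; lia.
have fz := split_flag_vector ub Esp next.
have fz0 := split_flag_vector wb Esp2 next2.
have varphi0 := split_neq0 ub Esp next; have phi0 := split_neq0 wb Esp2 next2.
have [c c0 diag] := up_coord_diag ub wb Esp Esp2 Essp (ex_intro _ _ (flag_cyclic fz)).
pose r h := c * \prod_(h.+1 <= k < d.+1) (phi k / varphi k).
exists (u d), (w d), r; split=> // [h|h hd|h hd].
- pose D := \prod_(h.+1 <= k < d.+1) (ths h - ths k).
  have D0 : D != 0.
    rewrite /D prodf_seq_neq0; apply/allP => k; rewrite mem_index_iota => kP /=.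
    rewrite subr_eq0.
    have kd : (k < d.+1)%N by case/andP: kP.
    have := inj_eq (spectral_inj Essp) h (Ordinal kd); rewrite -val_eqE /= => ->.
    by rewrite ltn_eqF //; case/andP: kP.
  have P0 : \prod_(h.+1 <= k < d.+1) varphi k != 0.
    rewrite prodf_seq_neq0; apply/allP => k; rewrite mem_index_iota => kP /=.
    by apply: varphi0; lia.
  apply: (scalerI D0); rewrite (up_coord_top wb Essp) diag.
  rewrite scalerA [RHS]scalerA [D * _]mulrC -[RHS]scalerA (up_coord_top ub Essp).
  rewrite [RHS]scalerA /r prodf_div; congr (_ *: _).
  by rewrite -mulrA divfK // mulrC.
- rewrite /r mulf_neq0 // prodf_seq_neq0.
  apply/allP => k; rewrite mem_index_iota => kP /=.
  by rewrite mulf_neq0 ?invr_eq0 ?phi0 ?varphi0 //; lia.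
by rewrite /r big_ltn // mulrCA.
Qed.

End LeonardFrame.

(** * Balanced forms in coordinates *)

Section BilinearForm.
Variables (K : fieldType) (M N : lmodType K) (b : M -> N -> K).
Hypothesis b_bilin : bilinear_for *%R *%R b.

Lemma form0l v : b 0 v = 0.
Proof.
have := b_bilin.1 v (-1) 0 0.
by rewrite /= scaler0 addr0 mulN1r addNr.
Qed.

Lemma form0r u : b u 0 = 0.
Proof.
have := b_bilin.2 u (-1) 0 0.
by rewrite /= scaler0 addr0 mulN1r addNr.
Qed.

Lemma formDl u u' v : b (u + u') v = b u v + b u' v.
Proof. by have := b_bilin.1 v 1 u u'; rewrite /= scale1r mul1r. Qed.

Lemma formDr u v v' : b u (v + v') = b u v + b u v'.
Proof. by have := b_bilin.2 u 1 v v'; rewrite /= scale1r mul1r. Qed.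

Lemma formZl c u v : b (c *: u) v = c * b u v.
Proof. by have := b_bilin.1 v c u 0; rewrite /= form0l !addr0. Qed.

Lemma formZr c u v : b u (c *: v) = c * b u v.
Proof. by have := b_bilin.2 u c v 0; rewrite /= form0r !addr0. Qed.

Lemma form_sum m n (F : 'I_m -> M) (G : 'I_n -> N) :
  b (\sum_i F i) (\sum_j G j) = \sum_j \sum_i b (F i) (G j).
Proof.
rewrite (big_morph (b _) (formDr _) (form0r _)); apply: eq_bigr => j _.
exact: (big_morph (b^~ (G j)) (fun u u' => formDl u u' (G j)) (form0l _)).
Qed.

Lemma form_sum0 m n (F : 'I_m -> M) (G : 'I_n -> N) :
  (forall i j, b (F i) (G j) = 0) -> b (\sum_i F i) (\sum_j G j) = 0.
Proof. by move=> bFG; rewrite form_sum big1 // => j _; rewrite big1. Qed.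

End BilinearForm.

Section Coordinates.
Variables (K : fieldType) (A : algType K) (V : lmodType A) (d : nat).
Variables (s : A) (ths : nat -> K) (Es : 'I_d.+1 -> A) (z : vspace_of V).
Hypothesis Essp : spectral V s ths Es.
Hypothesis cyc : forall v : vspace_of V, exists p, v = pact s p z.

Lemma cyclic_coord_neq0 h : act (Es h) z != 0.
Proof.
have [v] := spectral_neq0 Essp h; have [p ->] := cyc v.
by rewrite (spectral_poly Essp) scaler_eq0 => /norP[].
Qed.

Lemma cyclic_coord_exists h v : exists c, act (Es h) v == c *: act (Es h) z.
Proof. by have [p ->] := cyc v; exists p.[ths h]; rewrite (spectral_poly Essp). Qed.

Definition coordinate h v : K := xchoose (cyclic_coord_exists h v).

Lemma coordinateE h v : act (Es h) v = coordinate h v *: act (Es h) z.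
Proof. exact/eqP/(xchooseP (cyclic_coord_exists h v)). Qed.

Lemma coordinate_uniq h v c : act (Es h) v = c *: act (Es h) z -> coordinate h v = c.
Proof.
rewrite coordinateE => /eqP; rewrite -subr_eq0 -scalerBl scaler_eq0.
by rewrite (negPf (cyclic_coord_neq0 h)) orbF subr_eq0 => /eqP.
Qed.

Lemma coordinate_linear h c u v :
  coordinate h (c *: u + v) = c * coordinate h u + coordinate h v.
Proof.
apply: coordinate_uniq; rewrite linearP /= (coordinateE h u) (coordinateE h v).
by rewrite scalerA -scalerDl.
Qed.

Lemma coordinate_poly h p v :
  coordinate h (pact s p v) = p.[ths h] * coordinate h v.
Proof. by apply: coordinate_uniq; rewrite (spectral_poly Essp) coordinateE scalerA. Qed.

Lemma coordinate_self h : coordinate h z = 1.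
Proof. by apply: coordinate_uniq; rewrite scale1r. Qed.

Lemma coordinate_idempotent h i v :
  coordinate h (act (Es i) v) = (h == i)%:R * coordinate h v.
Proof.
apply: coordinate_uniq; rewrite (spectral_orth Essp) -scalerA -coordinateE.
by case: eqVneq => [->|_] //; rewrite !scale0r.
Qed.

End Coordinates.

Section BalancedForms.
Variables (K : fieldType) (d d' : nat) (A A' : algType K).
Variables (V : lmodType A) (V' : lmodType A').
Variables (Phi : leonard_data A d) (Phi' : leonard_data A' d').
Variables (th ths varphi phi th' ths' varphi' phi' : nat -> K) (rho : nat).
Hypotheses (le_d'd : (d' <= d)%N) (le_rho : (rho <= d - d')%N).
Hypothesis Esp : spectral V (lA Phi) th (lE Phi).
Hypothesis Essp : spectral V (lAs Phi) ths (lEs Phi).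
Hypothesis Esp' : spectral V' (lA Phi') th' (lE Phi').
Hypothesis Essp' : spectral V' (lAs Phi') ths' (lEs Phi').
Variables (z z0 : vspace_of V) (y y0 : vspace_of V') (r r' : nat -> K).
Hypothesis fr : leonard_frame Phi varphi phi z z0 r.
Hypothesis fr' : leonard_frame Phi' varphi' phi' y y0 r'.

Let sh (j : 'I_d'.+1) : 'I_d.+1 := inord (rho + j).
Let t (j : 'I_d'.+1) : K := ths (rho + j).
Let W := node_weight t.

Let shE j : sh j = (rho + j)%N :> nat.
Proof. by rewrite inordK //; have := ltn_ord j; lia. Qed.

Let sh_le (j : 'I_d'.+1) : (rho + j <= d)%N.
Proof. by have := ltn_ord j; lia. Qed.

Lemma shifted_nodes_inj : injective t.
Proof.
move=> i j tij; have : sh i = sh j by apply: (spectral_inj Essp); rewrite !shE.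
by move/(congr1 val); rewrite /= !shE => /addnI/val_inj.
Qed.

(** By [frame_ratio_step], the right-hand side equates the quotients of consecutive
    values of [r'] and of the shifted sequence [r]. *)
Lemma ratio_condition :
  (exists c, forall j : 'I_d'.+1, r' j = c * r (rho + j)%N) <->
  (forall i, (1 <= i <= d')%N ->
    phi' i / varphi' i = phi (rho + i)%N / varphi (rho + i)%N).
Proof.
have step h : (h < d')%N -> r (rho + h)%N =
    phi (rho + h.+1)%N / varphi (rho + h.+1)%N * r (rho + h.+1)%N.
  by move=> hd; rewrite (frame_ratio_step fr) ?addnS //; lia.
split=> [[c rE] [//|i] id | ii].
  have r'i := rE (Ordinal (id : (i.+1 < d'.+1)%N)).
  have r'i0 := rE (Ordinal (ltnW (id : (i.+1 < d'.+1)%N))).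
  apply: (mulIf (frame_ratio_neq0 fr' id)).
  rewrite -(frame_ratio_step fr') // [LHS]r'i0 /= step // r'i /=.
  by rewrite mulrCA.
have r_rho : r rho != 0 by rewrite (frame_ratio_neq0 fr) //; lia.
exists (r' 0%N / r rho) => -[j /= jd].
elim: j jd => [|j IHj] jd; first by rewrite addn0 divfK.
have q0 : phi (rho + j.+1)%N / varphi (rho + j.+1)%N != 0.
  by rewrite mulf_neq0 ?invr_eq0 ?(frame_phi_neq0 fr) ?(frame_varphi_neq0 fr) //; lia.
apply: (mulfI q0); rewrite -[in LHS]ii; last by lia.
rewrite -(frame_ratio_step fr') // IHj ?(ltnW jd) // step //.
by rewrite mulrCA.
Qed.

Section FormGiven.
Variable b : vspace_of V -> vspace_of V' -> K.
Hypothesis bal : balanced V V' Phi Phi' rho b.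

Let b_bilin := balanced_bilinear bal.

(** Condition [balanced_B1] leaves only the matching pairs of eigenspaces,
    on which [p] and [q] act as scalars. *)
Lemma balanced_expand (p q : {poly K}) x x' :
  b (pact (lAs Phi) p x) (pact (lAs Phi') q x') =
  \sum_j b (act (lEs Phi (sh j)) x) (act (lEs Phi' j) x') * (p.[t j] * q.[ths' j]).
Proof.
rewrite -[pact (lAs Phi) p x](spectral_sum Essp).
rewrite -[pact (lAs Phi') q x'](spectral_sum Essp').
rewrite (form_sum b_bilin); apply: eq_bigr => j _.
rewrite (bigD1 (sh j)) //= big1 ?addr0 => [|i ij]; last first.
  apply: (balanced_B1 bal) => ijE; move: ij; rewrite -val_eqE /= shE ijE.
  by rewrite eqxx.
rewrite (spectral_poly Essp) (spectral_poly Essp') shE.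
by rewrite (formZl b_bilin) (formZr b_bilin) mulrA mulrC.
Qed.

(** The first argument lies in the sum of the first [size p] eigenspaces of
    [lA Phi], and the second one in the sum of the last [size q] eigenspaces of
    [lA Phi']: every pair of indices that occurs satisfies [i < j]. *)
Lemma balanced_vanish_first (p q : {poly K}) : (size p + size q <= d'.+1)%N ->
  b (pact (lAs Phi) p z0) (pact (lAs Phi') q y) = 0.
Proof.
move=> pq; rewrite -[pact (lAs Phi) p z0](spectral_sum Esp).
rewrite -[pact (lAs Phi') q y](spectral_sum Esp').
apply: (form_sum0 b_bilin) => i j.
have jd := ltn_ord j; have id := ltn_ord i.
have [sp|sp] := leqP (size p) i.
  have := flag_kill (frame_first fr) (i := rev_ord i) (p := p).
  by rewrite rev_ordK => -> /=; [rewrite (form0l b_bilin) | rewrite subSS subKn].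
have [sq|sq] := leqP (size q) (d' - j).
  by rewrite (flag_kill (frame_last fr')) // (form0r b_bilin).
by apply: (balanced_B2 bal); left; lia.
Qed.

(** Here every pair of indices that occurs satisfies [i > j + (d - d')]. *)
Lemma balanced_vanish_last (p q : {poly K}) : (size p + size q <= d'.+1)%N ->
  b (pact (lAs Phi) p z) (pact (lAs Phi') q y0) = 0.
Proof.
move=> pq; rewrite -[pact (lAs Phi) p z](spectral_sum Esp).
rewrite -[pact (lAs Phi') q y0](spectral_sum Esp').
apply: (form_sum0 b_bilin) => i j.
have jd := ltn_ord j; have id := ltn_ord i.
have [sp|sp] := leqP (size p) (d - i).
  by rewrite (flag_kill (frame_last fr)) // (form0l b_bilin).
have [sq|sq] := leqP (size q) j.
  have := flag_kill (frame_first fr') (i := rev_ord j) (p := q).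
  by rewrite rev_ordK => -> /=; [rewrite (form0r b_bilin) | rewrite subSS subKn].
by apply: (balanced_B2 bal); right; lia.
Qed.

Definition balanced_weight (j : 'I_d'.+1) : K :=
  b (act (lEs Phi (sh j)) z0) (act (lEs Phi' j) y).

Lemma balanced_weight_vanish (p : {poly K}) : (size p <= d')%N ->
  \sum_j balanced_weight j * p.[t j] = 0.
Proof.
move=> sp; have b0 : b (pact (lAs Phi) p z0) (pact (lAs Phi') 1 y) = 0.
  by apply: balanced_vanish_first; rewrite size_poly1 addn1.
by rewrite -[RHS]b0 balanced_expand; apply: eq_bigr => j _; rewrite hornerC mulr1.
Qed.

Lemma balanced_weight_neq0 : exists j, balanced_weight j != 0.
Proof.
apply/existsP; have [u [v]] := balanced_neq0 bal; apply: contraNT.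
rewrite negb_exists => /forallP w0.
have [p ->] := flag_cyclic (frame_first fr) u.
have [q ->] := flag_cyclic (frame_last fr') v.
rewrite balanced_expand big1 // => j _.
by have := w0 j; rewrite negbK /balanced_weight => /eqP->; rewrite mul0r.
Qed.

Lemma balanced_weight_proportional : exists2 c : K, c != 0 &
  forall j, balanced_weight j = c * W j.
Proof.
have wE := weights_proportional shifted_nodes_inj balanced_weight_vanish.
exists (\sum_j balanced_weight j * t j ^+ d'); last exact: wE.
have [j] := balanced_weight_neq0; apply: contraNneq => c0.
by rewrite wE c0 mul0r.
Qed.

(** [balanced_vanish_first] at [q = 'X] says that the weights multiplied by
    [ths' j] still annihilate the polynomials of degree less than [d' - 1]. *)
Lemma balanced_affine : exists xi zeta : K,
  forall i, (i <= d')%N -> ths' i = xi * ths (rho + i)%N + zeta.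
Proof.
have [|p sp|xi [zeta E]] := affine_of_vanish shifted_nodes_inj
    balanced_weight_vanish (s := fun j => ths' j).
- exact: balanced_weight_neq0.
- have b0 : b (pact (lAs Phi) p z0) (pact (lAs Phi') 'X y) = 0.
    by apply: balanced_vanish_first; rewrite size_polyX; lia.
  rewrite -[RHS]b0 balanced_expand; apply: eq_bigr => j _.
  by rewrite hornerX -mulrA [ths' j * _]mulrC.
by exists xi, zeta => i id; apply: (E (Ordinal (id : (i < d'.+1)%N))).
Qed.

(** The weights computed from [z] and [y0] are again proportional to [W]; they
    differ from [balanced_weight] by the factors [r' j / r (rho + j)]. *)
Lemma balanced_ratio : exists c, forall j : 'I_d'.+1, r' j = c * r (rho + j)%N.
Proof.
have [c1 c10 wE] := balanced_weight_proportional.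
pose w2 j := b (act (lEs Phi (sh j)) z) (act (lEs Phi' j) y0).
have w2_vanish (p : {poly K}) : (size p <= d')%N -> \sum_j w2 j * p.[t j] = 0.
  move=> sp; have b0 : b (pact (lAs Phi) p z) (pact (lAs Phi') 1 y0) = 0.
    by apply: balanced_vanish_last; rewrite size_poly1 addn1.
  by rewrite -[RHS]b0 balanced_expand; apply: eq_bigr => j _; rewrite hornerC mulr1.
have w2E := weights_proportional shifted_nodes_inj w2_vanish.
set c2 := \sum_j _ in w2E; exists (c2 / c1) => j.
have W0 : W j != 0 := node_weight_neq0 shifted_nodes_inj j.
have rW : balanced_weight j * r' j = w2 j * r (rho + j)%N.
  rewrite /balanced_weight /w2 (frame_ratio fr) (frame_ratio fr') shE.
  by rewrite (formZl b_bilin) (formZr b_bilin) mulrC mulrCA mulrC.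
have : c1 * W j * r' j = c1 * W j * (c2 / c1 * r (rho + j)%N).
  rewrite -wE rW w2E wE !mulrA; congr (_ * _).
  by rewrite -[c1 * _ * c2]mulrA [c1 * _]mulrC mulfK // mulrC.
by apply: mulfI; rewrite mulf_neq0.
Qed.

End FormGiven.

Lemma balanced_unique b1 b2 :
    balanced V V' Phi Phi' rho b1 -> balanced V V' Phi Phi' rho b2 ->
  exists2 c : K, c != 0 & forall u v, b2 u v = c * b1 u v.
Proof.
move=> bal1 bal2; have [c1 c10 w1] := balanced_weight_proportional bal1.
have [c2 c20 w2] := balanced_weight_proportional bal2.
exists (c2 / c1) => [|u v]; first by rewrite mulf_neq0 ?invr_eq0.
have [p ->] := flag_cyclic (frame_first fr) u.
have [q ->] := flag_cyclic (frame_last fr') v.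
rewrite (balanced_expand bal1) (balanced_expand bal2) mulr_sumr.
apply: eq_bigr => j _.
rewrite -/(balanced_weight b1 j) -/(balanced_weight b2 j) w1 w2.
by rewrite !mulrA divfK.
Qed.

Section FormBuilt.
Variables xi zeta c : K.
Hypothesis affine : forall j : 'I_d'.+1, ths' j = xi * t j + zeta.
Hypothesis ratio : forall j : 'I_d'.+1, r' j = c * r (rho + j)%N.

Let co := coordinate Essp (flag_cyclic (frame_first fr)).
Let co' := coordinate Essp' (flag_cyclic (frame_last fr')).

(** With coordinates normalised at [z0] and [y], the weights of this form in the
    sense of [balanced_weight] are the numbers [W j]. *)
Definition built_form (u : vspace_of V) (v : vspace_of V') : K :=
  \sum_j W j * (co (sh j) u * co' j v).

Lemma built_form_bilinear : bilinear_for *%R *%R built_form.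
Proof.
split=> [v|u] k x1 x2; rewrite /= /built_form mulr_sumr -big_split /=;
  apply: eq_bigr => j _; rewrite /co /co' coordinate_linear.
- by rewrite mulrDl mulrDr; congr (_ + _); rewrite -mulrA mulrCA.
- rewrite !mulrDr; congr (_ + _) => //.
  by rewrite [LHS]mulrA [LHS]mulrCA !mulrA.
Qed.

(** As [ths' j] is affine in the node [t j], the product of the two values is
    the value at [t j] of a polynomial of degree less than [d']. *)
Lemma weight_vanish_mixed (p q : {poly K}) : (size p + (size q).-1 <= d')%N ->
  \sum_j W j * (p.[t j] * q.[ths' j]) = 0.
Proof.
move=> pq; pose l := xi *: 'X + zeta%:P.
rewrite -[RHS](node_weight_vanish shifted_nodes_inj (p := p * (q \Po l))).
  apply: eq_bigr => j _.
  by rewrite hornerM horner_comp /l hornerD hornerZ hornerX hornerC affine.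
have sl : ((size l).-1 <= 1)%N.
  have : (size l <= 2)%N; last by lia.
  rewrite (leq_trans (size_polyD _ _)) // geq_max.
  rewrite (leq_trans (size_scale_leq _ _)) ?size_polyX //=.
  exact: leq_trans (size_polyC_leq1 _) _.
have sc := size_comp_poly_leq q l.
have sc2 : ((size q).-1 * (size l).-1 <= (size q).-1)%N.
  by rewrite -[leqRHS]muln1 leq_mul2l sl orbT.
have := size_polyMleq p (q \Po l); lia.
Qed.

(** For [i < j] both vectors are polynomials in the dual operators applied to [z0]
    and [y], and the vanishing is [weight_vanish_mixed]. In the other range they
    are obtained from [z] and [y0], whose coordinates contribute to each term the
    factor [r' k / r (rho + k)], which is the constant [c]. *)
Lemma built_form_balanced : balanced V V' Phi Phi' rho built_form.
Proof.
split=> // [||i j u v ij|i j u v ij].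
- exact: built_form_bilinear.
- exists (act (lEs Phi (sh ord0)) z0), (act (lEs Phi' ord0) y).
  rewrite /built_form (bigD1 ord0) //= big1 => [|j j0]; last first.
    by rewrite /co' coordinate_idempotent (negPf j0) mul0r !mulr0.
  rewrite /co /co' !coordinate_idempotent !coordinate_self !eqxx !mulr1 addr0.
  exact: node_weight_neq0 shifted_nodes_inj _.
- rewrite -[lEs Phi i *: u]/(act (lEs Phi i) u) -[lEs Phi' j *: v]/(act (lEs Phi' j) v).
  rewrite /built_form big1 // => k _; rewrite /co /co' !coordinate_idempotent.
  have [kj|_] := eqVneq k j; last by rewrite mul0r !mulr0.
  suff /negPf-> : sh k != i by rewrite mul0r mul0r mulr0.
  by apply: contra_not_neq ij => <-; rewrite shE kj.
rewrite -[lE Phi i *: u]/(act (lE Phi i) u) -[lE Phi' j *: v]/(act (lE Phi' j) v).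
have id := ltn_ord i; have jd := ltn_ord j.
case: ij => ij.
  have [p sp pE] := flag_poly (frame_first fr) (rev_ord i) u.
  have ri : (d - rev_ord i)%N = i by rewrite /= subSS subKn.
  rewrite rev_ordK ri in sp pE.
  have [q sq ->] := flag_poly (frame_last fr') j v.
  rewrite pE /built_form -[RHS](@weight_vanish_mixed p q); last by lia.
  apply: eq_bigr => k _; rewrite /co /co' !coordinate_poly !coordinate_self.
  by rewrite !mulr1 shE.
have [p sp ->] := flag_poly (frame_last fr) i u.
have [q sq qE] := flag_poly (frame_first fr') (rev_ord j) v.
have rj : (d' - rev_ord j)%N = j by rewrite /= subSS subKn.
rewrite rev_ordK rj in sq qE.
rewrite qE /built_form -[RHS](mulr0 c).
rewrite -[X in _ = c * X](@weight_vanish_mixed p q); last by lia.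
rewrite mulr_sumr; apply: eq_bigr => k _.
have coz : co (sh k) z = (r (rho + k)%N)^-1.
  apply: coordinate_uniq; rewrite (frame_ratio fr) shE scalerA mulVf ?scale1r //.
  exact: (frame_ratio_neq0 fr).
have coy : co' k y0 = r' k by apply: coordinate_uniq; rewrite (frame_ratio fr').
rewrite /co /co' !coordinate_poly -/co -/co' coz coy ratio shE.
have r0 := frame_ratio_neq0 fr (sh_le k).
rewrite [X in W k * X]mulrACA [(r _)^-1 * _]mulrCA mulVf // mulr1.
by rewrite [RHS]mulrC mulrA.
Qed.

End FormBuilt.

End BalancedForms.

(** * Characterisation of descendents *)

Theorem mainTheorem1 (K : fieldType) (d d' : nat) (A A' : algType K)
    (V : lmodType A) (V' : lmodType A')
    (Phi : leonard_data A d) (Phi' : leonard_data A' d')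
    (th ths varphi phi th' ths' varphi' phi' : nat -> K) (rho : nat)
    (hd' : (1 <= d')%N) (hd : (d' <= d)%N)
    (hPhi : leonard_system V Phi) (hPhi' : leonard_system V' Phi')
    (hp : parameter_array V Phi th ths varphi phi)
    (hp' : parameter_array V' Phi' th' ths' varphi' phi')
    (hrho : (rho <= d - d')%N) :
  let cond_i := exists xis zetas : K,
    forall i : nat, (i <= d')%N -> ths' i = xis * ths (rho + i)%N + zetas in
  let cond_ii := forall i : nat, (1 <= i <= d')%N ->
    phi' i / varphi' i = phi (rho + i)%N / varphi (rho + i)%N in
  (descendent V V' Phi Phi' rho <-> cond_i /\ cond_ii) /\
  (cond_i /\ cond_ii ->
   forall b1 b2 : vspace_of V -> vspace_of V' -> K,
     balanced V V' Phi Phi' rho b1 -> balanced V V' Phi Phi' rho b2 ->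
     exists2 c : K, c != 0 & forall u v, b2 u v = c * b1 u v).
Proof.
move=> cond_i cond_ii.
have Esp := leonard_spectral hPhi hp; have Essp := leonard_spectral_dual hPhi hp.
have Esp' := leonard_spectral hPhi' hp'.
have Essp' := leonard_spectral_dual hPhi' hp'.
have [z [z0 [r fr]]] := leonard_frame_exists hPhi hp.
have [y [y0 [r' fr']]] := leonard_frame_exists hPhi' hp'.
have ratioE := ratio_condition hd hrho fr fr'.
split; last first.
  by move=> _ b1 b2; apply: (balanced_unique hd hrho Esp Essp Esp' Essp' fr fr').
split=> [[b bal]|[[xi [zeta affine]] /ratioE[c ratio]]].
  split; first exact: (balanced_affine hd hrho Esp Essp Esp' Essp' fr fr' bal).
  exact/ratioE/(balanced_ratio hd hrho Esp Essp Esp' Essp' fr fr' bal).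
exists (built_form rho Essp Essp' fr fr').
apply: (built_form_balanced hd hrho Essp Essp' fr fr' (xi := xi) (zeta := zeta)).
  by move=> j; apply: affine; rewrite -ltnS.
exact: ratio.
Qed.
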